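(* If $X$ is a cofibrant flow, then the homotopy branching space $\mathrm{ho}\mathbb{P}^-X$ and the branching space $\mathbb{P}^-X$ are homotopy equivalent.
   Context: $\mathbf{Top}$ is the category of compactly generated topological spaces (weak Hausdorff $k$-spaces). A flow $X$ consists of a compactly generated space $\mathbb{P}X$ (the path space), a discrete space $X^0$ (the set of states), continuous maps $s,t:\mathbb{P}X\to X^0$, and a continuous associative map $*:\{(x,y)\in\mathbb{P}X\times\mathbb{P}X;\ t(x)=s(y)\}\to\mathbb{P}X$ with $s(x*y)=s(x)$ and $t(x*y)=t(y)$. A morphism of flows $f:X\to Y$ consists of a set map $f^0:X^0\to Y^0$ and a continuous map $\mathbb{P}f:\mathbb{P}X\to\mathbb{P}Y$ compatible with $s$, $t$ and $*$. The category of flows is $\mathbf{Flow}$. It carries a unique model structure such that: the weak equivalences are the weak S-homotopy equivalences, i.e. the morphisms $f$ with $f^0$ a bijection and $\mathbb{P}f$ a weak homotopy equivalence; the fibrations are the morphisms $f$ with $\mathbb{P}f$ a Serre fibration. (This model structure may be taken as known.) A flow is cofibrant if $\varnothing\to X$ is a cofibration of this model structure. $Q$ denotes its cofibrant replacement functor: $\varnothing\to X$ factors functorially as a cofibration $\varnothing\to Q(X)$ followed by a trivial fibration $Q(X)\to X$. The branching space $\mathbb{P}^-X$ of a flow $X$ is the compactly generated space equipped with a continuous map $h^-:\mathbb{P}X\to\mathbb{P}^-X$ universal among continuous maps $\phi$ from $\mathbb{P}X$ to compactly generated spaces with $\phi(x)=\phi(x*y)$ whenever $t(x)=s(y)$.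 The homotopy branching space is $\mathrm{ho}\mathbb{P}^-X:=\mathbb{P}^-Q(X)$. *)

(* Defs.v *)
From HB Require Import structures.
From mathcomp Require Import all_boot all_order all_algebra.
From mathcomp Require Import all_classical all_reals all_analysis.

Set Implicit Arguments.
Unset Strict Implicit.
Unset Printing Implicit Defensive.

Import Order.TTheory GRing.Theory Num.Theory.
Import numFieldTopology.Exports numFieldNormedType.Exports.

Local Open Scope classical_set_scope.
Local Open Scope ring_scope.

Definition k_open (T : topologicalType) (U : set T) : Prop :=
  forall (K : topologicalType) (u : K -> T),
    compact [set: K] -> hausdorff_space K -> continuous u -> open (u @^-1` U).

Definition k_space (T : topologicalType) : Prop :=
  forall U : set T, k_open U -> open U.

Definition weak_hausdorff (T : topologicalType) : Prop :=
  forall (K : topologicalType) (u : K -> T),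
    compact [set: K] -> hausdorff_space K -> continuous u -> closed (range u).

Record cg_space := CGSpace {
  cg_sort :> topologicalType;
  cg_weak_hausdorff : weak_hausdorff cg_sort;
  cg_k_space : k_space cg_sort
}.

(* [kify T] is T with its k-open sets as open sets.  Finite limits in the
   category of compactly generated spaces are computed by applying [kify] to
   the usual topological limits. *)
Definition kify (T : topologicalType) : Type := T.

HB.instance Definition _ (T : topologicalType) := Choice.on (kify T).

Section Kify.
Variable T : topologicalType.

Lemma k_openT : k_open [set: T].
Proof. by move=> K u _ _ _; rewrite preimage_setT; exact: openT. Qed.

Lemma k_openI : setI_closed (@k_open T).
Proof.
move=> U V kU kV K u cK hK cu; rewrite preimage_setI.
by apply: openI; [exact: kU|exact: kV].
Qed.

Lemma k_open_bigU (I : Type) (f : I -> set T) :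
  (forall i, k_open (f i)) -> k_open (\bigcup_i f i).
Proof.
move=> kf K u cK hK cu; rewrite preimage_bigcup.
by apply: bigcup_open => i _; exact: kf.
Qed.

HB.instance Definition _ :=
  isOpenTopological.Build (kify T) k_openT k_openI k_open_bigU.

Lemma open_kifyE (U : set (kify T)) : open U = @k_open T U.
Proof. by []. Qed.

End Kify.

Definition unit_interval (R : realType) : topologicalType :=
  set_type (`[0, 1]%classic : set R).

Lemma mem_zero_unit_interval (R : realType) : (0 : R) \in `[0, 1]%classic.
Proof. by rewrite inE /= in_itv /= lexx ler01. Qed.

Lemma mem_one_unit_interval (R : realType) : (1 : R) \in `[0, 1]%classic.
Proof. by rewrite inE /= in_itv /= lexx ler01. Qed.

Definition I0 (R : realType) : unit_interval R :=
  exist _ 0 (mem_zero_unit_interval R).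

Definition I1 (R : realType) : unit_interval R :=
  exist _ 1 (mem_one_unit_interval R).

Definition cube (R : realType) (n : nat) : topologicalType :=
  prod_topology (fun _ : 'I_n => unit_interval R).

Definition cube_boundary (R : realType) (n : nat) : set (cube R n) :=
  [set x | exists i : 'I_n, x i = I0 R \/ x i = I1 R].

Definition cylinder (R : realType) (A : topologicalType) : topologicalType :=
  (A * unit_interval R)%type.

Definition path_connected_to (R : realType) (A : topologicalType) (a b : A) :=
  exists g : unit_interval R -> A, [/\ continuous g, g (I0 R) = a & g (I1 R) = b].

(* Representatives of the elements of pi_n(A, a). *)
Definition based_cube (R : realType) (n : nat) (A : topologicalType) (a : A)
    (g : cube R n -> A) : Prop :=
  continuous g /\ forall x, cube_boundary x -> g x = a.

Definition homotopic_rel_boundary (R : realType) (n : nat)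
    (A : topologicalType) (f g : cube R n -> A) : Prop :=
  exists H : cylinder R (cube R n) -> A,
    [/\ continuous H,
        forall x, H (x, I0 R) = f x,
        forall x, H (x, I1 R) = g x &
        forall x t, cube_boundary x -> H (x, t) = f x].

Definition pi0_bijective (R : realType) (A B : topologicalType) (f : A -> B) :=
  (forall a a', path_connected_to R (f a) (f a') -> path_connected_to R a a') /\
  (forall b, exists a, path_connected_to R (f a) b).

(* As f induces a group homomorphism pi_n(A, a) -> pi_n(B, f a) for n > 0, it
   is an isomorphism as soon as it is injective and surjective. *)
Definition pi_bijective (R : realType) (n : nat) (A B : topologicalType)
    (f : A -> B) (a : A) : Prop :=
  (forall g g' : cube R n -> A, based_cube a g -> based_cube a g' ->
     homotopic_rel_boundary (f \o g) (f \o g') -> homotopic_rel_boundary g g') /\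
  (forall k : cube R n -> B, based_cube (f a) k ->
     exists2 g, based_cube a g & homotopic_rel_boundary (f \o g) k).

Definition weak_homotopy_equivalence (R : realType) (A B : topologicalType)
    (f : A -> B) : Prop :=
  [/\ continuous f, pi0_bijective R f &
      forall (n : nat) (a : A), (0 < n)%N -> pi_bijective R n f a].

Definition serre_fibration (R : realType) (E B : topologicalType)
    (p : E -> B) : Prop :=
  continuous p /\
  forall (n : nat) (g : cube R n -> E)
         (H : cylinder R (cube R n) -> B),
    continuous g -> continuous H -> (forall x, H (x, I0 R) = p (g x)) ->
    exists G : cylinder R (cube R n) -> E,
      [/\ continuous G, forall x, G (x, I0 R) = g x & forall z, p (G z) = H z].

Definition homotopic (R : realType) (A B : cg_space) (f g : A -> B) : Prop :=
  exists H : kify (cylinder R A) -> B,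
    [/\ continuous H,
        forall a, H (a, I0 R) = f a &
        forall a, H (a, I1 R) = g a].

Definition homotopy_equivalent (R : realType) (A B : cg_space) : Prop :=
  exists (f : A -> B) (g : B -> A),
    [/\ continuous f, continuous g,
        homotopic R (g \o f) id & homotopic R (f \o g) id].

Record category := Category {
  obj : Type;
  mor : obj -> obj -> Type;
  idm : forall A, mor A A;
  compm : forall A B C, mor B C -> mor A B -> mor A C;
  comp_idl : forall A B (f : mor A B), compm (idm B) f = f;
  comp_idr : forall A B (f : mor A B), compm f (idm A) = f;
  compA : forall A B C D (h : mor C D) (g : mor B C) (f : mor A B),
    compm h (compm g f) = compm (compm h g) f
}.

Arguments mor {c} _ _.
Arguments idm {c} A.
Arguments compm {c A B C} _ _.

Definition morphism_class (C : category) := forall A B : obj C, mor A B -> Prop.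

Definition is_retract (C : category) (A B A' B' : obj C)
    (f : mor A B) (g : mor A' B') : Prop :=
  exists (i : mor A A') (r : mor A' A) (j : mor B B') (q : mor B' B),
    [/\ compm r i = idm A, compm q j = idm B,
        compm g i = compm j f & compm f r = compm q g].

Definition closed_under_retracts (C : category) (P : morphism_class C) :=
  forall (A B A' B' : obj C) (f : mor A B) (g : mor A' B'),
    is_retract f g -> P _ _ g -> P _ _ f.

Definition has_lifting (C : category) (A B X Y : obj C)
    (i : mor A B) (p : mor X Y) : Prop :=
  forall (u : mor A X) (v : mor B Y), compm p u = compm v i ->
    exists h : mor B X, compm h i = u /\ compm p h = v.

Record model_structure (C : category) := ModelStructure {
  weq : morphism_class C;
  cof : morphism_class C;
  fib : morphism_class C;
  weq_comp : forall (A B D : obj C) (f : mor A B) (g : mor B D),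
    weq f -> weq g -> weq (compm g f);
  weq_cancel_left : forall (A B D : obj C) (f : mor A B) (g : mor B D),
    weq f -> weq (compm g f) -> weq g;
  weq_cancel_right : forall (A B D : obj C) (f : mor A B) (g : mor B D),
    weq g -> weq (compm g f) -> weq f;
  weq_retract : closed_under_retracts weq;
  cof_retract : closed_under_retracts cof;
  fib_retract : closed_under_retracts fib;
  cof_trivial_fib_lifting : forall (A B X Y : obj C) (i : mor A B) (p : mor X Y),
    cof i -> fib p -> weq p -> has_lifting i p;
  trivial_cof_fib_lifting : forall (A B X Y : obj C) (i : mor A B) (p : mor X Y),
    cof i -> weq i -> fib p -> has_lifting i p;
  cof_trivial_fib_factor : forall (A B : obj C) (f : mor A B),
    exists (D : obj C) (i : mor A D) (p : mor D B),
      [/\ cof i, fib p, weq p & compm p i = f];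
  trivial_cof_fib_factor : forall (A B : obj C) (f : mor A B),
    exists (D : obj C) (i : mor A D) (p : mor D B),
      [/\ cof i, weq i, fib p & compm p i = f]
}.

Arguments weq {C} m {A B} _.
Arguments cof {C} m {A B} _.
Arguments fib {C} m {A B} _.

Definition composable (P S : topologicalType) (s t : P -> S) : set (P * P) :=
  [set z | t z.1 = s z.2].

Definition composable_space (P S : topologicalType) (s t : P -> S) :
  topologicalType := set_type (composable s t).

Definition composable_pair (P S : topologicalType) (s t : P -> S) (x y : P)
    (e : t x = s y) : composable_space s t :=
  exist _ (x, y) (mem_set (e : composable s t (x, y))).

Record flow := Flow {
  state : discreteTopologicalType;
  path_space : cg_space;
  src : path_space -> state;
  tgt : path_space -> state;
  src_continuous : continuous src;
  tgt_continuous : continuous tgt;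
  concat : kify (composable_space src tgt) -> path_space;
  concat_continuous : continuous concat;
  src_concat : forall x y (e : tgt x = src y),
    src (concat (composable_pair e)) = src x;
  tgt_concat : forall x y (e : tgt x = src y),
    tgt (concat (composable_pair e)) = tgt y;
  concatA : forall x y z (exy : tgt x = src y) (eyz : tgt y = src z)
      (exy_z : tgt (concat (composable_pair exy)) = src z)
      (ex_yz : tgt x = src (concat (composable_pair eyz))),
    concat (composable_pair exy_z) = concat (composable_pair ex_yz)
}.

Definition pcomp (X : flow) (x y : path_space X) (e : tgt x = src y) : path_space X :=
  concat (composable_pair e).

Record flow_morphism (X Y : flow) := FlowMorphism {
  on_state : state X -> state Y;
  on_path : path_space X -> path_space Y;
  on_path_continuous : continuous on_path;
  on_path_src : forall x, src (on_path x) = on_state (src x);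
  on_path_tgt : forall x, tgt (on_path x) = on_state (tgt x);
  on_path_pcomp : forall x y (e : tgt x = src y)
      (e' : tgt (on_path x) = src (on_path y)),
    on_path (pcomp e) = pcomp e'
}.

Lemma flow_morphism_ext (X Y : flow) (f g : flow_morphism X Y) :
  on_state f = on_state g -> on_path f = on_path g -> f = g.
Proof.
case: f g => [f0 f1 a b c d] [g0 g1 a' b' c' d'] /= e0 e1.
move: a b c d a' b' c' d'; rewrite e0 e1 => a b c d a' b' c' d'.
by congr FlowMorphism; exact: Prop_irrelevance.
Qed.

Program Definition flow_id (X : flow) : flow_morphism X X :=
  @FlowMorphism X X id id _ _ _ _.
Next Obligation. by move=> X x. Qed.
Next Obligation. by []. Qed.
Next Obligation. by []. Qed.
Next Obligation. by move=> X x y e e'; rewrite (Prop_irrelevance e e'). Qed.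

Program Definition flow_comp (X Y Z : flow) (g : flow_morphism Y Z)
    (f : flow_morphism X Y) : flow_morphism X Z :=
  @FlowMorphism X Z (on_state g \o on_state f) (on_path g \o on_path f) _ _ _ _.
Next Obligation.
move=> X Y Z g f x; apply: continuous_comp; exact: on_path_continuous.
Qed.
Next Obligation. by move=> X Y Z g f x /=; rewrite !on_path_src. Qed.
Next Obligation. by move=> X Y Z g f x /=; rewrite !on_path_tgt. Qed.
Next Obligation.
move=> X Y Z g f x y e e' /=.
have e1 : tgt (on_path f x) = src (on_path f y).
  by rewrite on_path_tgt on_path_src e.
by rewrite (on_path_pcomp e e1) (on_path_pcomp e1 e').
Qed.

Program Definition Flow_cat : category :=
  @Category flow flow_morphism flow_id flow_comp _ _ _.
Next Obligation. by move=> *; exact: flow_morphism_ext. Qed.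
Next Obligation. by move=> *; exact: flow_morphism_ext. Qed.
Next Obligation. by move=> *; exact: flow_morphism_ext. Qed.

Definition weak_S_homotopy_equivalence (R : realType) (X Y : flow)
    (f : flow_morphism X Y) : Prop :=
  bijective (on_state f) /\ weak_homotopy_equivalence R (on_path f).

Definition flow_fibration (R : realType) (X Y : flow)
    (f : flow_morphism X Y) : Prop :=
  serre_fibration R (on_path f).

Definition empty_space : cg_space.
Proof.
exists (discrete_topology void : topologicalType).
- by move=> K u _ _ _; rewrite (_ : range u = setT);
    [exact: closedT | apply/seteqP; split => -[]].
- by move=> U _; exact: discrete_open.
Defined.

Definition empty_map (T : Type) (x : empty_space) : T :=
  of_void T x.

Definition flow0 : flow.
Proof.
exists (discrete_topology void) empty_space (empty_map _) (empty_map _)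
  (fun z => empty_map empty_space (val z).1); by do ?case.
Defined.

Definition from_flow0 (X : flow) : flow_morphism flow0 X.
Proof. by exists (of_void (state X)) (empty_map (path_space X)); case. Defined.

Lemma from_flow0_unique (X : flow) (f : flow_morphism flow0 X) :
  f = from_flow0 X.
Proof. by apply: flow_morphism_ext; apply: funext; case. Qed.

Definition cofibrant (M : model_structure Flow_cat) (X : flow) : Prop :=
  cof M (from_flow0 X).

(* The factorization of flow0 -> X through repl X commutes automatically, by
   [from_flow0_unique]. *)
Record cofibrant_replacement (M : model_structure Flow_cat) := CofRepl {
  repl :> flow -> flow;
  repl_map : forall X Y, flow_morphism X Y -> flow_morphism (repl X) (repl Y);
  repl_map_id : forall X, repl_map (flow_id X) = flow_id (repl X);
  repl_map_comp : forall X Y Z (g : flow_morphism Y Z) (f : flow_morphism X Y),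
    repl_map (flow_comp g f) = flow_comp (repl_map g) (repl_map f);
  repl_proj : forall X, flow_morphism (repl X) X;
  repl_proj_natural : forall X Y (f : flow_morphism X Y),
    flow_comp (repl_proj Y) (repl_map f) = flow_comp f (repl_proj X);
  repl_cofibrant : forall X, cofibrant M (repl X);
  repl_proj_fib : forall X,
    fib M (repl_proj X);
  repl_proj_weq : forall X,
    weq M (repl_proj X)
}.

Definition branching_invariant (X : flow) (Z : cg_space) (phi : path_space X -> Z) :=
  continuous phi /\
  forall x y (e : tgt x = src y), phi x = phi (pcomp e).

(* A branching space is determined up to a unique compatible homeomorphism;
   an element of [branching_space X] is one choice of it. *)
Record branching_space (X : flow) := BranchingSpace {
  bspace :> cg_space;
  hminus : path_space X -> bspace;
  hminus_invariant : branching_invariant hminus;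
  hminus_universal : forall (Z : cg_space) (phi : path_space X -> Z),
    branching_invariant phi ->
    exists! psi : bspace -> Z, continuous psi /\ forall x, psi (hminus x) = phi x
}.

Definition ho_branching_space (M : model_structure Flow_cat)
    (Q : cofibrant_replacement M) (X : flow) : Type :=
  branching_space (Q X).

(* Main.v *)
Require Import Defs.
From mathcomp Require Import all_boot all_order all_algebra.
From mathcomp Require Import all_classical all_reals all_analysis.
From mathcomp Require Import lra.

Set Implicit Arguments.
Unset Strict Implicit.
Unset Printing Implicit Defensive.

Import Order.TTheory GRing.Theory Num.Theory.
Import numFieldTopology.Exports numFieldNormedType.Exports.

Local Open Scope classical_set_scope.
Local Open Scope ring_scope.

(* As X is cofibrant, the trivial fibration p : Q(X) -> X has a section s.
   For any flow Y, the flow Y^[0,1] whose path space is the mapping space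
   Map([0,1], PY) comes with a fibration onto Y x Y given by the two endpoints,
   and a lifting argument in the model category produces a morphism
   Q(X) -> Q(X)^[0,1] from s p to the identity.  Composition with h^- sends it
   to a map PQ(X) -> Map([0,1], P^-Q(X)) that identifies x and x * y, hence
   factors through P^-Q(X); by adjunction the factorization is a homotopy from
   P^-(s) P^-(p) to the identity, while P^-(p) P^-(s) is the identity by
   functoriality. *)

(** * General topology: continuity, separation, compactness and pasting *)

Lemma compT_continuous (A B C : topologicalType) (f : A -> B) (g : B -> C) :
  continuous f -> continuous g -> continuous (g \o f).
Proof. by move=> cf cg x; apply: continuous_comp; [exact: cf|exact: cg]. Qed.

Lemma fst_continuous (A B : topologicalType) : continuous (@fst A B).
Proof. by move=> x; exact: cvg_fst. Qed.

Lemma snd_continuous (A B : topologicalType) : continuous (@snd A B).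
Proof. by move=> x; exact: cvg_snd. Qed.

Lemma pair_continuous (A B C : topologicalType) (f : A -> B) (g : A -> C) :
  continuous f -> continuous g -> continuous (fun x => (f x, g x)).
Proof. by move=> cf cg x; apply: cvg_pair; [exact: cf|exact: cg]. Qed.

Lemma cst_continuousT (A B : topologicalType) (b : B) :
  continuous (fun _ : A => b).
Proof. by move=> x; exact: cvg_cst. Qed.

Lemma set_type_continuous (A B : topologicalType) (D : set B)
    (f : A -> set_type D) :
  continuous (val \o f) -> continuous f.
Proof. by move=> cf; apply: continuous_comp_initial. Qed.

Lemma val_continuous (B : topologicalType) (D : set B) :
  continuous (val : set_type D -> B).
Proof. exact: initial_continuous. Qed.

Lemma injective_hausdorff (A B : topologicalType) (f : A -> B) :
  continuous f -> injective f -> hausdorff_space B -> hausdorff_space A.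
Proof.
move=> cf injf hB p q clpq; apply: injf; apply: hB => U V Up Vq.
by have [x [Ux Vx]] := clpq _ _ (cf _ _ Up) (cf _ _ Vq); exists (f x).
Qed.

Lemma prod_hausdorff (A B : topologicalType) :
  hausdorff_space A -> hausdorff_space B -> hausdorff_space (A * B)%type.
Proof.
move=> hA hB [a b] [a' b'] cl; congr pair.
- apply: hA => U V Ua Va'.
  have [x [Ux Vx]] := cl _ _ (@fst_continuous A B (a, b) U Ua)
    (@fst_continuous A B (a', b') V Va').
  by exists x.1.
- apply: hB => U V Ub Vb'.
  have [x [Ux Vx]] := cl _ _ (@snd_continuous A B (a, b) U Ub)
    (@snd_continuous A B (a', b') V Vb').
  by exists x.2.
Qed.

Lemma prod_compact (A B : topologicalType) :
  compact [set: A] -> compact [set: B] -> compact [set: A * B].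
Proof. by move=> cA cB; rewrite -setXTT; exact: compact_setX. Qed.

(** Turns compact subsets into compact spaces, the form required of test spaces. A filter on the
    subspace is pushed forward to [A]; a cluster point in [D] is a cluster point upstairs because
    open sets of the subspace are traces. *)
Lemma set_type_compact (A : topologicalType) (D : set A) :
  compact D -> compact [set: set_type D].
Proof.
move=> cD F FF _.
have [|p [Dp clp]] := cD (val @ F) _.
  rewrite nbhs_simpl /= (_ : _ @^-1` _ = setT); first exact: filterT.
  by apply/seteqP; split=> // x _; exact: set_valP.
exists (exist _ p (mem_set Dp)); split=> // U V FU [_ [[W oW <-] /= Wp] WV].
have [||x [[y Uy <-] Wy]] := clp ((val : set_type D -> A) @` U) W.
- by rewrite nbhs_simpl /=; apply: filterS FU => x Ux; exists x.
- exact: open_nbhs_nbhs.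
by exists y; split=> //; apply: WV.
Qed.

(** The Boolean [p] only selects the branch. As the branches agree on the overlap, the preimage of a
    closed set is the union of its parts in [C] and [D], both closed. *)
Lemma pasting (A B : topologicalType) (C D : set A) (p : pred A)
    (f g : A -> B) :
  closed C -> closed D -> (forall x, p x -> C x) -> (forall x, ~~ p x -> D x) ->
  continuous f -> continuous g -> (forall x, C x -> D x -> f x = g x) ->
  continuous (fun x => if p x then f x else g x).
Proof.
move=> cC cD pC pD /continuous_closedP cf /continuous_closedP cg fg.
apply/continuous_closedP => E cE.
rewrite [X in closed X](_ : _ = (C `&` f @^-1` E) `|` (D `&` g @^-1` E)).
  by apply: closedU; apply: closedI => //; [exact: cf|exact: cg].
apply/seteqP; split=> x /=.
  by case: ifPn => [/pC|/pD]; [left|right].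
case: ifPn => [/pC Cx|/pD Dx] [] [H1 H2] //; last by rewrite -fg.
by rewrite fg.
Qed.

(** * Compactly generated spaces *)

Lemma compact_hausdorff_k_space (K : topologicalType) :
  compact [set: K] -> hausdorff_space K -> k_space K.
Proof. by move=> cK hK U kU; apply: (kU K id) => // x. Qed.

Lemma k_space_continuous (Z T : topologicalType) (f : Z -> T) : k_space Z ->
  (forall (K : topologicalType) (u : K -> Z),
    compact [set: K] -> hausdorff_space K -> continuous u ->
    continuous (f \o u)) -> continuous f.
Proof.
move=> kZ H; apply/continuousP => U oU; apply: kZ => K u cK hK cu.
by move/continuousP: (H K u cK hK cu); apply.
Qed.

(** Universal property of k-ification: a test map into [Z] followed by [f] is a test map into
    [T]. *)
Lemma continuous_to_kify (Z T : topologicalType) (f : Z -> T) : k_space Z ->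
  continuous f -> continuous (f : Z -> kify T).
Proof.
move=> kZ cf; apply/continuousP => U kU; apply: kZ => K u cK hK cu.
exact: (kU K (f \o u) cK hK (compT_continuous cu cf)).
Qed.

Lemma of_kify_continuous (T : topologicalType) :
  continuous (fun x : kify T => (x : T)).
Proof.
apply/continuousP => U oU; rewrite open_kifyE => K u _ _ cu.
by move/continuousP: cu; apply.
Qed.

Lemma continuous_to_kifyW (Z T : topologicalType) (f : Z -> kify T) :
  continuous f -> continuous (f : Z -> T).
Proof. by move=> cf; exact: (compT_continuous cf (@of_kify_continuous T)). Qed.

Lemma continuous_of_kify (T Z : topologicalType) (f : T -> Z) :
  continuous f -> continuous (f : kify T -> Z).
Proof. exact: (compT_continuous (@of_kify_continuous T)). Qed.

Lemma kify_k_space (T : topologicalType) : k_space (kify T).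
Proof.
move=> U kU; rewrite open_kifyE => K u cK hK cu; apply: (kU K u) => //.
by apply: continuous_to_kify => //; exact: compact_hausdorff_k_space.
Qed.

Lemma kify_continuous (T Z : topologicalType) (f : T -> Z) :
  (forall (K : topologicalType) (u : K -> T),
    compact [set: K] -> hausdorff_space K -> continuous u ->
    continuous (f \o u)) -> continuous (f : kify T -> Z).
Proof.
move=> H; apply: k_space_continuous; first exact: kify_k_space.
by move=> K u cK hK /continuous_to_kifyW; exact: H.
Qed.

(** A point is the image of the one-point compact Hausdorff space. *)
Lemma weak_hausdorff_closed1 (P : topologicalType) (x : P) :
  weak_hausdorff P -> closed [set x].
Proof.
move=> wP; have := wP (discrete_topology unit) (fun=> x).
rewrite (_ : range _ = [set x]); last first.
  by apply/seteqP; split=> [_ [t _ <-]//|_ ->]; exists tt.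
apply.
- by apply: finite_compact; exact: finite_finset.
- exact: discrete_hausdorff.
- by move=> t; exact: cvg_cst.
Qed.

(** If [a k] differs from [b l], regularity of [K] gives a closed neighbourhood of [k] whose image
    under [a] avoids [b l]. This neighbourhood is compact, so its image is closed in [P], and the
    complement pulls back along [b] to a neighbourhood of [l]. *)
Lemma weak_hausdorff_coincidence (P K L : topologicalType)
    (a : K -> P) (b : L -> P) : weak_hausdorff P ->
  compact [set: K] -> hausdorff_space K -> continuous a -> continuous b ->
  closed [set z : K * L | a z.1 = b z.2].
Proof.
move=> wP cK hK ca cb; rewrite -openC openE => -[k l] /= akl.
have aV : nbhs k (a @^-1` (~` [set b l])).
  apply: open_nbhs_nbhs; split=> //.
  move/continuousP: ca; apply; rewrite openC; exact: weak_hausdorff_closed1.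
have [U Uk UV] := compact_regular hK cK filterT aV.
pose C := set_type (closure U).
have cl : closed (range (a \o (val : C -> K))).
  apply: wP.
  - apply: set_type_compact; apply: (subclosed_compact _ cK) => //.
    exact: closed_closure.
  - by apply: (injective_hausdorff (@val_continuous _ _)) => //; exact: val_inj.
  - by apply: compT_continuous => //; exact: val_continuous.
exists (U, b @^-1` (~` range (a \o (val : C -> K)))) => /=.
  split=> //; apply: open_nbhs_nbhs; split.
    by move/continuousP: cb; apply; rewrite openC.
  by move=> [c _ /=]; apply: UV; exact: set_valP.
case=> k' l' [/= Uk' nb] e; apply: nb.
by exists (exist _ k' (mem_set (subset_closure Uk'))).
Qed.

(* The range of [u] pulls back along [v] to the projection, along a compact
   factor, of an intersection of coincidence sets. *)
Lemma weak_hausdorff_kify (T : topologicalType) (J : Type)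
    (P : J -> topologicalType) (f : forall j, T -> P j) :
  (forall j, weak_hausdorff (P j)) -> (forall j, continuous (f j)) ->
  (forall x y, (forall j, f j x = f j y) -> x = y) -> weak_hausdorff (kify T).
Proof.
move=> wP cf injf K u cK hK /continuous_to_kifyW cu.
rewrite -openC open_kifyE => L v cL hL cv.
rewrite preimage_setC openC.
rewrite [X in closed X](_ : _ = snd @`
    (\bigcap_j [set z : K * L | f j (u z.1) = f j (v z.2)])).
  apply: compact_closed => //; apply: continuous_compact.
    by apply: continuous_subspaceT => x; exact: cvg_snd.
  apply: (subclosed_compact _ (prod_compact cK cL)) => //.
  apply: closed_bigI => j _.
  by apply: (@weak_hausdorff_coincidence _ _ _ (f j \o u) (f j \o v)) => //;
    exact: compT_continuous.
apply/seteqP; split=> l /=.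
  by move=> [k _ ukl]; exists (k, l) => // j _ /=; rewrite ukl.
by case=> -[k l'] /= H <-; exists k => //; apply: injf => j; exact: H.
Qed.

(** * Mapping spaces *)

(** The compact-open topology lives on all functions; pulling it back to bundled continuous
    functions leaves only continuous points. *)
Definition mapping (I P : topologicalType) : topologicalType :=
  initial_topology
    (fun f : continuousType I P => (f : I -> P) : {compact-open, I -> P}).

Definition ev (I P : topologicalType) (g : mapping I P) : I -> P :=
  (g : continuousType I P).

Definition mk_mapping (I P : topologicalType) (f : I -> P) (cf : continuous f) :
  mapping I P := mkcts cf : continuousType I P.

Lemma ev_continuous (I P : topologicalType) (g : mapping I P) :
  continuous (ev g).
Proof. exact: (@cts_fun _ _ (g : continuousType I P)). Qed.

Lemma mapping_ext (I P : topologicalType) (g h : mapping I P) :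
  ev g =1 ev h -> g = h.
Proof. by move=> gh; apply/(@continuousEP I P). Qed.

Lemma mapping_curry (Z I P : topologicalType) (f : Z -> mapping I P) :
  continuous (fun z : Z * I => ev (f z.1) z.2) -> continuous f.
Proof.
move=> cf; apply: continuous_comp_initial.
exact: (continuous_curry_fun cf).
Qed.

Lemma mapping_uncurry (Z I P : topologicalType) (f : Z -> mapping I P) :
  compact [set: I] -> hausdorff_space I -> continuous f ->
  continuous (fun z : Z * I => ev (f z.1) z.2).
Proof.
move=> cI hI cf.
have cF : continuous (fun z : Z => ev (f z) : {compact-open, I -> P}).
  by apply: (compT_continuous cf); exact: initial_continuous.
have := @continuous_uncurry _ _ _
  (fun z : Z => ev (f z) : {compact-open, I -> P}).
rewrite (_ : uncurry _ = (fun z : Z * I => ev (f z.1) z.2)); last first.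
  by apply: funext => -[].
apply => //; last by move=> u; exact: ev_continuous.
(* Local compactness: [I] being compact, the whole space is a compact closed neighbourhood of each
   point. *)
move=> x _; rewrite withinET; exists setT; first exact: filterT.
by split; [|exact: closedT].
Qed.

(** The maps sending the compact set [[set t]] into an open set form an open set of the compact-open
    topology. *)
Lemma ev_at_continuous (I P : topologicalType) (t : I) :
  continuous (fun g : mapping I P => ev g t).
Proof.
move=> g U; rewrite /= nbhsE => -[V [oV Vg] VU].
have : open_nbhs (ev g : {compact-open, I -> P})
    [set h : {compact-open, I -> P} | h @` [set t] `<=` V].
  by split; [apply: compact_open_open => //; exact: compact_set1 |
             move=> _ [_ -> <-]].
move=> /open_nbhs_nbhs /(@initial_continuous (continuousType I P) _ _ g).
rewrite !nbhs_simpl /=; apply: filterS => h H.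
by apply: VU; apply: H; exists t.
Qed.

(** Weak Hausdorffness comes from the evaluations at points of [I], which are continuous and jointly
    injective. *)
Definition map_space (I : topologicalType) (P : cg_space) : cg_space.
Proof.
exists (kify (mapping I P)); last exact: kify_k_space.
apply: (@weak_hausdorff_kify _ I (fun=> P) (fun t g => ev g t)).
- by move=> _; exact: cg_weak_hausdorff.
- by move=> t; exact: ev_at_continuous.
- by move=> g h; exact: mapping_ext.
Defined.

Definition map_ev (I : topologicalType) (P : cg_space) (g : map_space I P) :
  I -> P := @ev I P g.

Lemma map_ev_continuous (I : topologicalType) (P : cg_space)
    (g : map_space I P) : continuous (map_ev g).
Proof. exact: ev_continuous. Qed.

Lemma map_ev_at_continuous (I : topologicalType) (P : cg_space) (t : I) :
  continuous (fun g : map_space I P => map_ev g t).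
Proof. by apply: continuous_of_kify; exact: ev_at_continuous. Qed.

Lemma map_space_ext (I : topologicalType) (P : cg_space)
    (g h : map_space I P) : map_ev g =1 map_ev h -> g = h.
Proof. exact: mapping_ext. Qed.

Lemma map_space_uncurry (Z I : topologicalType) (P : cg_space)
    (f : Z -> map_space I P) :
  compact [set: I] -> hausdorff_space I -> continuous f ->
  continuous (fun z : Z * I => map_ev (f z.1) z.2).
Proof. by move=> cI hI /continuous_to_kifyW; exact: mapping_uncurry. Qed.

Lemma map_space_curry (Z I : topologicalType) (P : cg_space)
    (f : Z -> map_space I P) : k_space Z ->
  continuous (fun z : Z * I => map_ev (f z.1) z.2) -> continuous f.
Proof.
by move=> kZ cf; apply: continuous_to_kify => //; exact: mapping_curry.
Qed.

Definition prod_space (P Q : cg_space) : cg_space.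
Proof.
exists (kify (P * Q)%type); last exact: kify_k_space.
apply: (@weak_hausdorff_kify _ bool (fun b => if b then P else Q)
  (fun b => if b return (P * Q -> if b then P else Q)%type then fst else snd)).
- by case; exact: cg_weak_hausdorff.
- by case=> x; [exact: cvg_fst|exact: cvg_snd].
- by move=> [x y] [x' y'] e; have /= -> := e true; have /= -> := e false.
Defined.

(** * The unit interval *)

Section UnitInterval.
Variable R : realType.
Local Notation I := (unit_interval R).

Lemma clamp_subproof (x : R) : Num.max 0 (Num.min 1 x) \in `[0, 1]%classic.
Proof.
by rewrite inE /= in_itv /= le_max lexx /= ge_max ler01 ge_min lexx.
Qed.

(** A retraction of the real line onto the interval, so that maps out of the interval can be
    reparametrized by real arithmetic. *)
Definition clamp (x : R) : I :=
  exist (fun y : R => y \in `[0, 1]%classic) _ (clamp_subproof x).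

Lemma val_clamp (x : R) : 0 <= x <= 1 -> val (clamp x) = x.
Proof. by case/andP=> x0 x1; rewrite /= (min_r x1) (max_r x0). Qed.

Lemma clamp_val (t : I) : clamp (val t) = t.
Proof.
apply: val_inj; apply: val_clamp.
by have := set_valP t; rewrite /= in_itv.
Qed.

Lemma clamp0 : clamp 0 = I0 R.
Proof. by apply: val_inj; rewrite val_clamp // lexx ler01. Qed.

Lemma clamp1 : clamp 1 = I1 R.
Proof. by apply: val_inj; rewrite val_clamp // lexx ler01. Qed.

Lemma clamp_continuous : continuous clamp.
Proof.
apply: set_type_continuous => x.
have := @continuous_max _ _ (fun=> 0) (Num.min 1 : R -> R^o) x.
apply; first exact: cvg_cst.
apply: (@continuous_min _ _ (fun=> 1) (id : R -> R^o)); first exact: cvg_cst.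
exact: cvg_id.
Qed.

Lemma unit_interval_compact : compact [set: I].
Proof. by apply: set_type_compact; exact: segment_compact. Qed.

Lemma unit_interval_hausdorff : hausdorff_space I.
Proof.
apply: (injective_hausdorff (@val_continuous _ _)); first exact: val_inj.
exact: Rhausdorff.
Qed.

Lemma unit_interval_k_space : k_space I.
Proof.
apply: compact_hausdorff_k_space.
  exact: unit_interval_compact.
exact: unit_interval_hausdorff.
Qed.

Lemma unit_interval_uncurry (Z : topologicalType) (P : cg_space)
    (f : Z -> map_space I P) : continuous f ->
  continuous (fun z : Z * I => map_ev (f z.1) z.2).
Proof.
apply: map_space_uncurry; first exact: unit_interval_compact.
exact: unit_interval_hausdorff.
Qed.

(** Extended to the line by [clamp], [f] has a clopen nonempty fibre over [f t], which is everything
    by connectedness. *)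
Lemma unit_interval_discrete_cst (S : discreteTopologicalType) (f : I -> S)
    (t t' : I) : continuous f -> f t = f t'.
Proof.
move=> cf; have cg : continuous (f \o clamp).
  exact: compT_continuous clamp_continuous cf.
have conR : connected [set: R].
  by apply/connected_intervalP => x y _ _ z _.
pose A := (f \o clamp) @^-1` [set f t].
have eA : A = [set: R].
  apply: (conR A).
  - by exists (val t); rewrite /A /= clamp_val.
  - exists A; last by rewrite setTI.
    by move/continuousP: cg; apply; exact: discrete_open.
  - exists A; last by rewrite setTI.
    by move/continuous_closedP: cg; apply; exact: discrete_closed.
have : A (val t') by rewrite eA.
by rewrite /A /= clamp_val.
Qed.

Lemma cube_compact n : compact [set: cube R n].
Proof.
have := @tychonoff 'I_n (fun=> I) (fun=> setT) (fun=> unit_interval_compact).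
by rewrite (_ : [set _ | _] = setT) //; apply/seteqP; split.
Qed.

Lemma cube_hausdorff n : hausdorff_space (cube R n).
Proof. by apply: hausdorff_product => _; exact: unit_interval_hausdorff. Qed.

(** Over a compact Hausdorff base the plain product is already a k-space, so continuity into k-ified
    spaces can be tested on it directly. *)
Lemma cylinder_k_space (A : topologicalType) :
  compact [set: A] -> hausdorff_space A -> k_space (cylinder R A).
Proof.
move=> cA hA; apply: compact_hausdorff_k_space.
  by apply: prod_compact => //; exact: unit_interval_compact.
by apply: prod_hausdorff => //; exact: unit_interval_hausdorff.
Qed.

End UnitInterval.

(** * Flows of paths and of pairs *)

(** Composition is continuous only on the k-ified space of composable pairs; the pairing reaches it
    continuously because [Z] is a k-space. *)
Lemma pcomp_continuous (Y : flow) (Z : topologicalType)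
    (a b : Z -> path_space Y) (e : forall z, tgt (a z) = src (b z)) :
  k_space Z -> continuous a -> continuous b ->
  continuous (fun z => Defs.pcomp (e z)).
Proof.
move=> kZ ca cb.
have cp : continuous (fun z => composable_pair (e z) :
    kify (composable_space (@src Y) (@tgt Y))).
  apply: continuous_to_kify => //; apply: set_type_continuous.
  exact: pair_continuous.
exact: compT_continuous cp (@concat_continuous Y).
Qed.

Lemma pcomp_eq (Y : flow) (x x' y y' : path_space Y) (e : tgt x = src y)
    (e' : tgt x' = src y') : x = x' -> y = y' -> Defs.pcomp e = Defs.pcomp e'.
Proof.
by move=> xx yy; subst x' y'; rewrite (Prop_irrelevance e e').
Qed.

Lemma src_pcomp (Y : flow) (x y : path_space Y) (e : tgt x = src y) :
  src (Defs.pcomp e) = src x.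
Proof. exact: src_concat. Qed.

Lemma tgt_pcomp (Y : flow) (x y : path_space Y) (e : tgt x = src y) :
  tgt (Defs.pcomp e) = tgt y.
Proof. exact: tgt_concat. Qed.

Lemma pcompA (Y : flow) (x y z : path_space Y) (exy : tgt x = src y)
    (eyz : tgt y = src z) (exy_z : tgt (Defs.pcomp exy) = src z)
    (ex_yz : tgt x = src (Defs.pcomp eyz)) :
  Defs.pcomp exy_z = Defs.pcomp ex_yz.
Proof. exact: concatA. Qed.

(** Reduces continuity of a composition law to compact Hausdorff families of composable pairs, where
    [pcomp_continuous] applies. *)
Lemma kify_composable_continuous (P S Z : topologicalType) (s t : P -> S)
    (f : composable_space s t -> Z) :
  (forall (K : topologicalType) (u : K -> composable_space s t),
    compact [set: K] -> hausdorff_space K ->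
    continuous (fun k => (val (u k)).1) ->
    continuous (fun k => (val (u k)).2) ->
    continuous (f \o u)) ->
  continuous (f : kify (composable_space s t) -> Z).
Proof.
move=> H; apply: kify_continuous => K u cK hK cu.
have cvu := compT_continuous cu (@val_continuous _ _).
apply: H => //.
- exact: compT_continuous cvu (@fst_continuous _ _).
- exact: compT_continuous cvu (@snd_continuous _ _).
Qed.

Section PathFlow.
Variables (R : realType) (Y : flow).
Local Notation I := (unit_interval R).
Local Notation PY := (map_space I (path_space Y)).

(** Time 0 is an arbitrary choice: states are discrete, so the source is constant along a path.
    Hence the path flow keeps the states of [Y]. *)
Definition path_src (g : PY) : state Y := src (map_ev g (I0 R)).
Definition path_tgt (g : PY) : state Y := tgt (map_ev g (I0 R)).

Lemma src_map_ev (g : PY) t : src (map_ev g t) = path_src g.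
Proof.
apply: (unit_interval_discrete_cst (f := fun t => src (map_ev g t))).
exact: compT_continuous (@map_ev_continuous _ _ g) (@src_continuous Y).
Qed.

Lemma tgt_map_ev (g : PY) t : tgt (map_ev g t) = path_tgt g.
Proof.
apply: (unit_interval_discrete_cst (f := fun t => tgt (map_ev g t))).
exact: compT_continuous (@map_ev_continuous _ _ g) (@tgt_continuous Y).
Qed.

Lemma path_composable (g h : PY) (e : path_tgt g = path_src h) t :
  tgt (map_ev g t) = src (map_ev h t).
Proof. by rewrite tgt_map_ev src_map_ev. Qed.

Lemma path_pcomp_subproof (g h : PY) (e : path_tgt g = path_src h) :
  continuous (fun t => Defs.pcomp (path_composable e t)).
Proof.
by apply: pcomp_continuous; [exact: unit_interval_k_space|
  exact: map_ev_continuous|exact: map_ev_continuous].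
Qed.

Definition path_pcomp (g h : PY) (e : path_tgt g = path_src h) : PY :=
  mk_mapping (@path_pcomp_subproof g h e).

Lemma map_ev_pcomp (g h : PY) (e : path_tgt g = path_src h) t
    (et : tgt (map_ev g t) = src (map_ev h t)) :
  map_ev (path_pcomp e) t = Defs.pcomp et.
Proof. exact: pcomp_eq. Qed.

Definition path_concat (z : kify (composable_space path_src path_tgt)) : PY :=
  path_pcomp (set_valP (z : composable_space path_src path_tgt)).

Lemma path_concat_continuous : continuous path_concat.
Proof.
apply: kify_composable_continuous => K u cK hK cu1 cu2.
apply: map_space_curry; first exact: compact_hausdorff_k_space.
have e (z : K * I) : tgt (map_ev (val (u z.1)).1 z.2) =
    src (map_ev (val (u z.1)).2 z.2).
  apply: path_composable; exact: (set_valP (u z.1)).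
rewrite [X in continuous X](_ : _ = fun z => Defs.pcomp (e z)); last first.
  by apply: funext => z; exact: map_ev_pcomp.
apply: pcomp_continuous.
- exact: cylinder_k_space.
- exact: unit_interval_uncurry cu1.
- exact: unit_interval_uncurry cu2.
Qed.

Definition path_flow : flow.
Proof.
apply: (@Flow (state Y) PY path_src path_tgt _ _ path_concat).
- apply: compT_continuous (@src_continuous Y); exact: map_ev_at_continuous.
- apply: compT_continuous (@tgt_continuous Y); exact: map_ev_at_continuous.
- exact: path_concat_continuous.
- by move=> x y e; exact: src_pcomp.
- by move=> x y e; exact: tgt_pcomp.
move=> x y z exy eyz exy_z ex_yz; apply: map_space_ext => t.
exact: pcompA.
Defined.

Definition path_flow_ev (t : I) : flow_morphism path_flow Y.
Proof.
apply: (@FlowMorphism path_flow Y id (fun g => map_ev g t)).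
- exact: map_ev_at_continuous.
- by move=> g; rewrite src_map_ev.
- by move=> g; rewrite tgt_map_ev.
by move=> x y e e'; exact: map_ev_pcomp.
Defined.

Definition const_path (x : path_space Y) : PY :=
  mk_mapping (@cst_continuousT I _ x).

Lemma const_path_continuous : continuous const_path.
Proof.
apply: map_space_curry; first exact: cg_k_space.
exact: fst_continuous.
Qed.

(** Followed by the two endpoint evaluations this is the diagonal of [Y]; it supplies the top side
    of the square in [section_homotopy]. *)
Definition path_flow_const : flow_morphism Y path_flow.
Proof.
apply: (@FlowMorphism Y path_flow id const_path) => //.
- exact: const_path_continuous.
by move=> x y e e'; apply: map_space_ext => t; exact: pcomp_eq.
Defined.

End PathFlow.

Section ProductFlow.
Variable Y : flow.
Local Notation S2 := (discrete_topology (state Y * state Y)%type).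
Local Notation P2 := (prod_space (path_space Y) (path_space Y)).

Definition path1 (z : P2) : path_space Y := (z : path_space Y * path_space Y).1.
Definition path2 (z : P2) : path_space Y := (z : path_space Y * path_space Y).2.
Definition paths (x y : path_space Y) : P2 := (x, y).

Lemma path1_continuous : continuous path1.
Proof. by apply: continuous_of_kify; exact: fst_continuous. Qed.

Lemma path2_continuous : continuous path2.
Proof. by apply: continuous_of_kify; exact: snd_continuous. Qed.

Lemma paths_continuous (Z : topologicalType) (f g : Z -> path_space Y) :
  k_space Z -> continuous f -> continuous g ->
  continuous (fun z => paths (f z) (g z)).
Proof.
by move=> kZ cf cg; apply: continuous_to_kify => //; exact: pair_continuous.
Qed.

(** The states of the product flow carry the discrete topology rather than the product one; every
    preimage is a union of intersections of open fibres. *)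
Lemma pair_discrete_continuous (Z : topologicalType) (f g : Z -> state Y) :
  continuous f -> continuous g -> continuous (fun z => (f z, g z) : S2).
Proof.
move=> /continuousP cf /continuousP cg; apply/continuousP => U _.
rewrite [X in open X](_ : _ =
    \bigcup_(d in U) (f @^-1` [set d.1] `&` g @^-1` [set d.2])).
  apply: bigcup_open => d _.
  by apply: openI; [apply: cf|apply: cg]; exact: discrete_open.
apply/seteqP; split=> z /=; first by exists (f z, g z).
by case=> -[a b] Uab [/= -> ->].
Qed.

Definition prod_src (z : P2) : S2 := (src (path1 z), src (path2 z)).
Definition prod_tgt (z : P2) : S2 := (tgt (path1 z), tgt (path2 z)).

Lemma prod_composable1 (z w : P2) :
  prod_tgt z = prod_src w -> tgt (path1 z) = src (path1 w).
Proof. by case. Qed.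

Lemma prod_composable2 (z w : P2) :
  prod_tgt z = prod_src w -> tgt (path2 z) = src (path2 w).
Proof. by case. Qed.

Definition prod_pcomp (z w : P2) (e : prod_tgt z = prod_src w) : P2 :=
  paths (Defs.pcomp (prod_composable1 e)) (Defs.pcomp (prod_composable2 e)).

Definition prod_concat (z : kify (composable_space prod_src prod_tgt)) : P2 :=
  prod_pcomp (set_valP (z : composable_space prod_src prod_tgt)).

Lemma prod_concat_continuous : continuous prod_concat.
Proof.
apply: kify_composable_continuous => K u cK hK cu1 cu2.
have kK := compact_hausdorff_k_space cK hK.
apply: paths_continuous => //; apply: pcomp_continuous => //.
- exact: compT_continuous cu1 path1_continuous.
- exact: compT_continuous cu2 path1_continuous.
- exact: compT_continuous cu1 path2_continuous.
- exact: compT_continuous cu2 path2_continuous.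
Qed.

Definition prod_flow : flow.
Proof.
apply: (@Flow S2 P2 prod_src prod_tgt _ _ prod_concat).
- apply: pair_discrete_continuous.
    exact: compT_continuous path1_continuous (@src_continuous Y).
  exact: compT_continuous path2_continuous (@src_continuous Y).
- apply: pair_discrete_continuous.
    exact: compT_continuous path1_continuous (@tgt_continuous Y).
  exact: compT_continuous path2_continuous (@tgt_continuous Y).
- exact: prod_concat_continuous.
- by move=> x y e; congr pair; exact: src_pcomp.
- by move=> x y e; congr pair; exact: tgt_pcomp.
by move=> x y z exy eyz exy_z ex_yz; congr paths; exact: pcompA.
Defined.

Definition flow_pair (A : flow) (f g : flow_morphism A Y) :
  flow_morphism A prod_flow.
Proof.
apply: (@FlowMorphism A prod_flow (fun a => (on_state f a, on_state g a))
  (fun x => paths (on_path f x) (on_path g x))).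
- apply: paths_continuous.
  + exact: cg_k_space.
  + exact: on_path_continuous.
  + exact: on_path_continuous.
- by move=> x; congr pair; exact: on_path_src.
- by move=> x; congr pair; exact: on_path_tgt.
by move=> x y e e'; congr paths; exact: on_path_pcomp.
Defined.

End ProductFlow.

(** * The endpoint fibration *)

Section Gluing.
Variables (R : realType) (A P : topologicalType).
Local Notation I := (unit_interval R).
Variables g h1 h2 : A * I -> P.

(** A path parametrized by the real line: [h1] backwards on [-1,0], [g] on [0,1], [h2] on [1,2], and
    constant beyond. *)
Definition glue3 (z : A * R) : P :=
  if z.2 <= 0 then h1 (z.1, clamp (- z.2)) else
  if z.2 <= 1 then g (z.1, clamp z.2) else h2 (z.1, clamp (z.2 - 1)).

Lemma glue3_continuous : continuous g -> continuous h1 -> continuous h2 ->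
  (forall a, h1 (a, I0 R) = g (a, I0 R)) ->
  (forall a, h2 (a, I0 R) = g (a, I1 R)) -> continuous glue3.
Proof.
move=> cg ch1 ch2 e1 e2.
have c1 : continuous (@fst A R) by exact: fst_continuous.
have c2 : continuous (@snd A R) by exact: snd_continuous.
have cl (f : A * R -> R) (k : A * I -> P) : continuous f -> continuous k ->
    continuous (fun z => k (z.1, clamp (f z))).
  move=> cf ck; apply: (compT_continuous _ ck); apply: pair_continuous => //.
  exact: compT_continuous cf (@clamp_continuous R).
have cle (c : R) : closed [set z : A * R | z.2 <= c].
  by move/continuous_closedP/(_ _ (@closed_le R c)): c2.
have cge (c : R) : closed [set z : A * R | c <= z.2].
  by move/continuous_closedP/(_ _ (@closed_ge R c)): c2.
apply: (pasting (cle 0) (cge 0)) => //.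
- by move=> z; rewrite -ltNge => /ltW.
- by apply: cl => // z; apply: continuousN; exact: c2.
- apply: (pasting (cle 1) (cge 1)) => //.
  + by move=> z; rewrite -ltNge => /ltW.
  + exact: cl.
  + by apply: cl => // z; apply: continuousB; [exact: c2|exact: cvg_cst].
  + move=> z /= z1 z1'; have -> : z.2 = 1 by apply/eqP; rewrite eq_le z1.
    by rewrite subrr clamp0 clamp1 e2.
- move=> z /= z1 z1'; have -> : z.2 = 0 by apply/eqP; rewrite eq_le z1.
  by rewrite oppr0 ler01 clamp0 e1.
Qed.

End Gluing.

Lemma unit_interval_ge0 (R : realType) (t : unit_interval R) : 0 <= val t.
Proof. by have := set_valP t; rewrite /= in_itv /= => /andP[]. Qed.

Lemma unit_interval_le1 (R : realType) (t : unit_interval R) : val t <= 1.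
Proof. by have := set_valP t; rewrite /= in_itv /= => /andP[]. Qed.

(* Extend the path [g x] on both sides by the paths traced by the two
   components of [H x] up to time [s], and run through the result at constant
   speed. *)
Lemma path_flow_fibration (R : realType) (Y : flow) :
  flow_fibration R (flow_pair (path_flow_ev Y (I0 R)) (path_flow_ev Y (I1 R))).
Proof.
split; first exact: on_path_continuous.
move=> n g H cg cH gH.
pose h1 z := path1 (H z); pose h2 z := path2 (H z).
pose gu (z : cube R n * unit_interval R) := map_ev (g z.1) z.2.
have ch1 : continuous h1 by exact: compT_continuous cH (@path1_continuous Y).
have ch2 : continuous h2 by exact: compT_continuous cH (@path2_continuous Y).
have cgu : continuous gu by exact: unit_interval_uncurry cg.
have e1 x : h1 (x, I0 R) = gu (x, I0 R) by rewrite /h1 gH.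
have e2 x : h2 (x, I0 R) = gu (x, I1 R) by rewrite /h2 gH.
have cG := glue3_continuous cgu ch1 ch2 e1 e2.
(* For lifting time [s = val z.1.2], the affine map from [0,1] onto [-s, 1+s], the stretch of
   [glue3] to be traversed. *)
pose tau (z : cylinder R (cube R n) * unit_interval R) : R :=
  val z.2 * (1 + 2 * val z.1.2) - val z.1.2.
have ctau : continuous tau.
  have cv1 : continuous (fun z : cylinder R (cube R n) * unit_interval R =>
      val z.1.2 : R).
    apply: compT_continuous (@val_continuous _ _).
    exact: compT_continuous (@fst_continuous _ _) (@snd_continuous _ _).
  have cv2 : continuous (fun z : cylinder R (cube R n) * unit_interval R =>
      val z.2 : R).
    exact: compT_continuous (@snd_continuous _ _) (@val_continuous _ _).
  rewrite /tau => z; apply: cvgB; last exact: cv1.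
  apply: cvgM; first exact: cv2.
  apply: cvgD; first exact: cvg_cst.
  by apply: cvgM; [exact: cvg_cst|exact: cv1].
pose F (z : cylinder R (cube R n) * unit_interval R) :=
  glue3 gu h1 h2 (z.1.1, tau z).
have cF : continuous F.
  apply: (compT_continuous _ cG); apply: pair_continuous => //.
  exact: compT_continuous (@fst_continuous _ _) (@fst_continuous _ _).
have cFz (z : cylinder R (cube R n)) : continuous (fun t => F (z, t)).
  apply: (compT_continuous _ cF); apply: pair_continuous.
    exact: cst_continuousT.
  by move=> t; exact: cvg_id.
pose G z : map_space (unit_interval R) (path_space Y) := mk_mapping (cFz z).
exists G; split.
- apply: map_space_curry.
    by apply: cylinder_k_space; [exact: cube_compact|exact: cube_hausdorff].
  by rewrite [X in continuous X](_ : _ = F) //; apply: funext => -[].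
- move=> x; apply: map_space_ext => t.
  change (F ((x, I0 R), t) = gu (x, t)).
  rewrite /F /tau /glue3 /= mulr0 addr0 mulr1 subr0 unit_interval_le1 clamp_val.
  (* At lifting time 0, [tau] is [val t], so the [h1] branch is taken only at [t = I0 R], where [h1]
     and [gu] agree. *)
  case: ifPn => // t0; have -> : t = I0 R.
    by apply: val_inj; apply/eqP; rewrite eq_le t0 unit_interval_ge0.
  by rewrite oppr0 clamp0 e1.
move=> [x s].
suff -> : H (x, s) = paths (h1 (x, s)) (h2 (x, s)).
  congr paths.
  - change (F ((x, s), I0 R) = h1 (x, s)).
    rewrite /F /tau /glue3 /= mul0r sub0r oppr_le0 unit_interval_ge0.
    by rewrite opprK clamp_val.
  - change (F ((x, s), I1 R) = h2 (x, s)).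
    have s0 := unit_interval_ge0 s.
    have affine (v : R) : 1 * (1 + 2 * v) - v = 1 + v by lra.
    rewrite /F (affine (val s) : tau ((x, s), I1 R) = _) /glue3 /=.
    rewrite ifN; last by rewrite -ltNge; exact: ltr_wpDr.
    (* The parameter [1 + val s] falls in the middle branch only for [s = I0 R], where [gu] ends at
       the start of [h2]. *)
    rewrite gerDl; case: ifPn => s1; last first.
      by rewrite addrC addrA addNr add0r clamp_val.
    have -> : s = I0 R by apply: val_inj; apply/eqP; rewrite eq_le s1 s0.
    by rewrite addr0 clamp1 e2.
by rewrite /h1 /h2; case: (H (x, s)).
Qed.

(** * Lifting arguments *)

(** Factoring the identity through a trivial fibration [p] exhibits it as a retract of [p]. *)
Lemma weq_id (C : category) (M : model_structure C) (A : obj C) :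
  weq M (idm A).
Proof.
have [D [i [p [_ _ wp pi]]]] := cof_trivial_fib_factor M (idm A).
apply: (weq_retract (g := p)) wp.
by exists i, p, (idm A), (idm A); rewrite !comp_idl pi.
Qed.

Lemma weq_section (C : category) (M : model_structure C) (A B : obj C)
    (p : mor A B) (s : mor B A) : weq M p -> compm p s = idm B -> weq M s.
Proof.
by move=> wp ps; apply: (weq_cancel_right wp); rewrite ps; exact: weq_id.
Qed.

(** The identity of [X] lifts against [p]; the square commutes because [flow0] is initial. *)
Lemma cofibrant_section (M : model_structure Flow_cat) (Y X : flow)
    (p : flow_morphism Y X) : cofibrant M X -> fib M p -> weq M p ->
  exists s : flow_morphism X Y, flow_comp p s = flow_id X.
Proof.
move=> cX fp wp.
have [|s [_ ps]] := cof_trivial_fib_lifting cX fp wp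
    (u := from_flow0 Y) (v := flow_id X); last by exists s.
transitivity (from_flow0 X); first exact: from_flow0_unique.
exact/esym/from_flow0_unique.
Qed.

Lemma flow_comp_pair (A B Y : flow) (f g : flow_morphism A Y)
    (h : flow_morphism B A) :
  flow_comp (flow_pair f g) h = flow_pair (flow_comp f h) (flow_comp g h).
Proof. exact: flow_morphism_ext. Qed.

Lemma flow_pair_on_path (A Y : flow) (f g f' g' : flow_morphism A Y) x :
  flow_pair f g = flow_pair f' g' ->
  on_path f x = on_path f' x /\ on_path g x = on_path g' x.
Proof.
by move=> /(congr1 (fun h => on_path h x)) /= [].
Qed.

(* Factor [s] as a trivial cofibration [j] followed by [r], which is then a
   trivial fibration; [r] and [s p r] agree after composition with [j], hence
   are joined by a path of morphisms, which a section of [r] pulls back to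
   [Y]. *)
Lemma section_homotopy (R : realType) (M : model_structure Flow_cat)
    (M_fib : forall (X Y : flow) (f : flow_morphism X Y),
       fib M f <-> flow_fibration R f)
    (Y X : flow) (p : flow_morphism Y X) (s : flow_morphism X Y) :
  cofibrant M Y -> weq M p -> flow_comp p s = flow_id X ->
  exists H : flow_morphism Y (path_flow R Y),
    forall x, map_ev (on_path H x) (I0 R) = on_path s (on_path p x) /\
      map_ev (on_path H x) (I1 R) = x.
Proof.
move=> cY wp ps.
have [D [j [r [cj wj fr rj]]]] :=
  trivial_cof_fib_factor M (s : @mor Flow_cat X Y).
(* [s] is a weak equivalence as a section of one, so two-out-of-three applies to [r j = s]. *)
have wr : weq M r.
  apply: (weq_cancel_left wj); rewrite rj.
  exact: (@weq_section Flow_cat M _ _ p s).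
have [k rk] := cofibrant_section cY fr wr.
have fE := (M_fib _ _ _).2 (path_flow_fibration R Y).
pose spr : flow_morphism D Y := flow_comp s (flow_comp p r).
have [|h [_ Eh]] := trivial_cof_fib_lifting cj wj fE
    (u := flow_comp (path_flow_const R Y) s) (v := flow_pair spr r).
  have sprj : flow_comp spr j = s.
    transitivity (flow_comp s (flow_comp p (flow_comp r j))).
      exact: flow_morphism_ext.
    rewrite (rj : flow_comp r j = s) ps; exact: flow_morphism_ext.
  transitivity (flow_pair s s); first exact: flow_morphism_ext.
  rewrite -[RHS]/(flow_comp (flow_pair spr r) j) flow_comp_pair sprj.
  by rewrite (rj : flow_comp r j = s).
exists (flow_comp h k).
(* Since [r k] is the identity, precomposition with [k] turns the endpoints [s p r] and [r] of [h]
   into [s p] and the identity. *)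
have Ehk : flow_pair (flow_comp (path_flow_ev Y (I0 R)) (flow_comp h k))
      (flow_comp (path_flow_ev Y (I1 R)) (flow_comp h k)) =
    flow_pair (flow_comp s p) (flow_id Y).
  rewrite -(rk : flow_comp r k = flow_id Y).
  transitivity (flow_comp (flow_pair spr r) k).
    rewrite -(Eh : flow_comp _ h = _); exact: flow_morphism_ext.
  rewrite flow_comp_pair; congr flow_pair.
  transitivity (flow_comp (flow_comp s p) (flow_comp r k)).
    exact: flow_morphism_ext.
  by rewrite (rk : flow_comp r k = flow_id Y); exact: flow_morphism_ext.
by move=> x; exact: flow_pair_on_path Ehk.
Qed.

(** * Branching spaces *)

(** Both maps are factorizations of the same invariant map, so uniqueness in the universal property
    identifies them. *)
Lemma branching_ext (X : flow) (B : branching_space X) (Z : cg_space)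
    (f g : B -> Z) : continuous f -> continuous g ->
  (forall x, f (hminus B x) = g (hminus B x)) -> f = g.
Proof.
move=> cf cg fg; have [ch hp] := hminus_invariant B.
have [|psi [_ U]] := @hminus_universal X B Z (f \o hminus B).
  split; first exact: compT_continuous ch cf.
  by move=> x y e /=; rewrite (hp _ _ e).
by rewrite -(U f) // -(U g) //; split=> // x; rewrite /= fg.
Qed.

Lemma hminus_on_path_invariant (X Y : flow) (f : flow_morphism X Y)
    (B : branching_space Y) :
  branching_invariant (fun x => hminus B (on_path f x)).
Proof.
have [ch hp] := hminus_invariant B; split.
  exact: compT_continuous (@on_path_continuous _ _ f) ch.
move=> x y e.
have e' : tgt (on_path f x) = src (on_path f y).
  by rewrite on_path_tgt on_path_src e.
by rewrite (on_path_pcomp e e') (hp _ _ e').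
Qed.

Lemma branching_map (X Y : flow) (f : flow_morphism X Y)
    (A : branching_space X) (B : branching_space Y) :
  exists2 g : A -> B, continuous g &
    forall x, g (hminus A x) = hminus B (on_path f x).
Proof.
have [g [[cg Eg] _]] := hminus_universal A (hminus_on_path_invariant f B).
by exists g.
Qed.

Lemma branching_homotopic (R : realType) (X Y : flow)
    (H : flow_morphism X (path_flow R Y))
    (A : branching_space X) (B : branching_space Y) (f g : A -> B) :
  continuous f -> continuous g ->
  (forall x, f (hminus A x) = hminus B (map_ev (on_path H x) (I0 R))) ->
  (forall x, g (hminus A x) = hminus B (map_ev (on_path H x) (I1 R))) ->
  homotopic R f g.
Proof.
move=> cf cg Ef Eg; have [ch hp] := hminus_invariant B.
have cH x : continuous (fun t => hminus B (map_ev (on_path H x) t)).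
  exact: compT_continuous (@map_ev_continuous _ _ _) ch.
pose phi x : map_space (unit_interval R) B := mk_mapping (cH x).
(* Taking the compactly generated mapping space as target gives the homotopy in adjoint form,
   avoiding any universal property for the product of [A] with the interval. *)
have [|psi [[cpsi Epsi] _]] := @hminus_universal X A _ phi.
  split.
    apply: map_space_curry; first exact: cg_k_space.
    have cu := unit_interval_uncurry (@on_path_continuous _ _ H).
    exact: compT_continuous cu ch.
  move=> x y e; apply: map_space_ext => t.
  (* Invariance of [phi] is checked at each time [t], where it is that of the flow morphism obtained
     by evaluating [H] at [t]. *)
  have [_ hpt] := hminus_on_path_invariant (flow_comp (path_flow_ev Y t) H) B.
  exact: hpt.
have psiE t (k : A -> B) : continuous k ->
    (forall x, k (hminus A x) = hminus B (map_ev (on_path H x) t)) ->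
    forall a, map_ev (psi a) t = k a.
  move=> ck Ek a.
  suff -> : k = fun b => map_ev (psi b) t by [].
  apply: branching_ext => // [|x]; last by rewrite Epsi Ek.
  exact: compT_continuous cpsi (@map_ev_at_continuous _ _ t).
exists (fun z => map_ev (psi (z : A * unit_interval R).1) z.2); split.
- apply: continuous_of_kify; exact: unit_interval_uncurry.
- by move=> a; exact: psiE.
- by move=> a; exact: psiE.
Qed.

Lemma homotopic_refl (R : realType) (A B : cg_space) (f : A -> B) :
  continuous f -> homotopic R f f.
Proof.
move=> cf; exists (fun z => f (z : A * unit_interval R).1); split=> //.
by apply: continuous_of_kify; exact: compT_continuous (@fst_continuous _ _) cf.
Qed.

Theorem proposition9p1 (R : realType) (M : model_structure Flow_cat)
    (M_weq : forall (X Y : flow) (f : flow_morphism X Y),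
       weq M f <-> weak_S_homotopy_equivalence R f)
    (M_fib : forall (X Y : flow) (f : flow_morphism X Y),
       fib M f <-> flow_fibration R f)
    (Q : cofibrant_replacement M)
    (X : flow) (X_cofibrant : cofibrant M X)
    (hoPX : ho_branching_space Q X) (PX : branching_space X) :
  homotopy_equivalent R (bspace hoPX) (bspace PX).
Proof.
have wp := repl_proj_weq Q X.
have [s ps] := cofibrant_section X_cofibrant (repl_proj_fib Q X) wp.
have [H EH] := section_homotopy M_fib (repl_cofibrant Q X) wp ps.
have [f cf Ef] := branching_map (repl_proj Q X) hoPX PX.
have [g cg Eg] := branching_map s PX hoPX.
exists f, g; split=> //.
- apply: (branching_homotopic (H := H)) => [||x|x].
  + exact: compT_continuous cf cg.
  + by move=> x; exact: cvg_id.
  + by rewrite /= Ef Eg (EH x).1.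
  + by rewrite (EH x).2.
(* This composite is strictly the identity: [p s] is the identity of [X], and maps out of [PX] are
   determined on the image of [hminus]. *)
- have -> : f \o g = id; last by apply: homotopic_refl => x; exact: cvg_id.
  apply: branching_ext => [||x]; [exact: compT_continuous cg cf| |].
    by move=> x; exact: cvg_id.
  by rewrite /= Eg Ef; congr (hminus PX _);
    exact: (congr1 (fun h : flow_morphism X X => on_path h x) ps).
Qed.
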